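(* Let $M,N\in\mathcal{LC}$ be given. Then the following are equivalent: (i) there exist $c\in\mathbb{N}_{>0}$ and $A\ge1$ such that $N_j\le A(M_{cj})^{1/c}$ for all $j\in\mathbb{N}$; (ii) $v_M\preceq^{\mathfrak c}v_N$; (iii) $H^{\infty}_{\underline{\mathcal M}^{\mathfrak c}}\subseteq H^{\infty}_{\underline{\mathcal N}^{\mathfrak c}}$, with continuous inclusion; (iv) $H^{\infty}_{\overline{\mathcal M}^{\mathfrak c}}\subseteq H^{\infty}_{\overline{\mathcal N}^{\mathfrak c}}$, with continuous inclusion. Consequently, $\sim^{\mathfrak c}$ characterizes the equivalence of the corresponding classes: $v_M\sim^{\mathfrak c}v_N$ if and only if $H^{\infty}_{\underline{\mathcal M}^{\mathfrak c}}=H^{\infty}_{\underline{\mathcal N}^{\mathfrak c}}$ as locally convex vector spaces, and if and only if $H^{\infty}_{\overline{\mathcal M}^{\mathfrak c}}=H^{\infty}_{\overline{\mathcal N}^{\mathfrak c}}$ as locally convex vector spaces.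
   Context: $\mathbb{N}=\{0,1,2,\dots\}$, $\mathbb{N}_{>0}=\{1,2,\dots\}$. A weight is a continuous, non-increasing function $v:[0,+\infty)\to(0,+\infty)$ with $\lim_{t\to+\infty}t^kv(t)=0$ for all $k\ge0$. $H(\mathbb{C})$ is the space of entire functions and $H^{\infty}_v:=\{f\in H(\mathbb{C}):\|f\|_v:=\sup_{z\in\mathbb{C}}|f(z)|v(|z|)<+\infty\}$, a Banach space with norm $\|\cdot\|_v$. $\mathcal{LC}$ is the set of sequences $M=(M_j)_{j\in\mathbb{N}}$ of positive reals with $1=M_0\le M_1$, $M_j^2\le M_{j-1}M_{j+1}$ for all $j\ge1$, and $\lim_{j\to+\infty}(M_j)^{1/j}=+\infty$. For $M\in\mathcal{LC}$ put $\omega_M(t):=\sup_{j\in\mathbb{N}}\log(t^j/M_j)$ for $t>0$, $\omega_M(0):=0$. For $c>0$ let $v^c_M(t):=\exp(-c\,\omega_M(t))$ and $v_M:=v^1_M$; these are weights. Put $\underline{\mathcal M}^{\mathfrak c}:=(v^c_M)_{c\in\mathbb{N}_{>0}}$ and $\overline{\mathcal M}^{\mathfrak c}:=(v^{1/c}_M)_{c\in\mathbb{N}_{>0}}$. $H^{\infty}_{\underline{\mathcal M}^{\mathfrak c}}:=\varinjlim_{c\to\infty}H^{\infty}_{v^c_M}$ is the locally convex inductive limit (an (LB)-space; as a set the union), and $H^{\infty}_{\overline{\mathcal M}^{\mathfrak c}}:=\varprojlim_{c\to\infty}H^{\infty}_{v^{1/c}_M}$ is the projective limit (a Fréchet space;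 as a set the intersection). Same notation with $N$, $\mathcal N$ in place of $M$, $\mathcal M$. For weights $v,w$: $v\preceq^{\mathfrak c}w$ means there are $c\ge1$ and $C\ge1$ with $w(t)^c\le Cv(t)$ for all $t\ge0$; $v\sim^{\mathfrak c}w$ means $v\preceq^{\mathfrak c}w$ and $w\preceq^{\mathfrak c}v$. *)

(* Defs.v *)
From HB Require Import structures.
From mathcomp Require Import all_boot all_order all_algebra.
From mathcomp Require Import all_classical all_reals all_analysis.
From mathcomp.real_closed Require Import complex.

Set Implicit Arguments.
Unset Strict Implicit.
Unset Printing Implicit Defensive.

Import Order.TTheory GRing.Theory Num.Theory.
Import numFieldNormedType.Exports.

Local Open Scope classical_set_scope.
Local Open Scope ring_scope.
Local Open Scope complex_scope.

Record weight (R : realType) := Weight {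
  weight_fun :> R -> R;
  weight_continuous : {within `[0, +oo[, continuous weight_fun};
  weight_nonincr : forall s t, 0 <= s -> s <= t -> weight_fun t <= weight_fun s;
  weight_gt0 : forall t, 0 <= t -> 0 < weight_fun t;
  weight_decay : forall k : nat, t ^+ k * weight_fun t @[t --> +oo] --> 0 }.

Record LC (R : realType) := MkLC {
  LC_seq :> nat -> R;
  LC_gt0 : forall j, 0 < LC_seq j;
  LC_0 : LC_seq 0%N = 1;
  LC_01 : LC_seq 0%N <= LC_seq 1%N;
  LC_logconvex : forall j, LC_seq j.+1 ^+ 2 <= LC_seq j * LC_seq j.+2;
  LC_root : LC_seq j `^ (j%:R^-1) @[j --> \oo] --> +oo }.

Section associated_weight.
Context (R : realType) (M : LC R).
Implicit Types (s t : R) (j : nat).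

Definition omega t : R :=
  if 0 < t then sup [set ln (t ^+ j / M j) | j in [set: nat]] else 0.

Lemma LC_ge1 j : 1 <= M j.
Proof.
suff /andP[] : (1 <= M j) && (M j <= M j.+1) by [].
elim: j => [|j /andP[M1 Mj]].
  by rewrite LC_0 lexx /= -[X in X <= _](LC_0 M) LC_01.
have M1' := le_trans M1 Mj; rewrite M1' /=.
rewrite -(ler_pM2l (LC_gt0 M j)); apply: le_trans (LC_logconvex M j).
by rewrite expr2 ler_pM2r // LC_gt0.
Qed.

Lemma LC_large (T : R) : exists J : nat, forall j t, 0 < t -> t <= T ->
  (J <= j)%N -> ln (t ^+ j / M j) <= 0.
Proof.
have /cvgryPge/(_ T)[J _ HJ] := @LC_root R M.
exists J.+1 => j t t0 tT Jj; apply: ln_le0.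
rewrite ler_pdivrMr ?LC_gt0 // mul1r.
have /= Tj := HJ j (ltnW Jj).
have j0 : (j%:R : R) != 0 by rewrite pnatr_eq0 -lt0n (leq_trans _ Jj).
have : t ^+ j <= (M j `^ (j%:R^-1)) ^+ j.
  by apply: lerXn2r; rewrite ?nnegrE ?powR_ge0 ?(ltW t0) // (le_trans tT).
by rewrite -[X in _ <= X -> _]powR_mulrn ?powR_ge0 // -powRrM mulVf // powRr1 // ltW // LC_gt0.
Qed.

Lemma omega_has_ubound t : 0 < t ->
  has_ubound [set ln (t ^+ j / M j) | j in [set: nat]].
Proof.
move=> t0; have [J HJ] := LC_large t.
exists (\sum_(j < J) `|ln (t ^+ j / M j)|) => _ [j _ <-].
have [Jj|jJ] := leqP J j.
  by apply: le_trans (HJ _ _ t0 (lexx _) Jj) _; apply: sumr_ge0.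
rewrite (bigD1 (Ordinal jJ)) //=; apply: le_trans (ler_norm _) _.
by rewrite lerDl sumr_ge0.
Qed.

Lemma omega_ge t j : 0 < t -> ln (t ^+ j / M j) <= omega t.
Proof.
move=> t0; rewrite /omega t0; apply: (sup_upper_bound _ _); last by exists j.
by split; [exists (ln (t ^+ 0 / M 0%N)), 0%N|exact: omega_has_ubound].
Qed.

Lemma omega_le t x : 0 < t -> (forall j, ln (t ^+ j / M j) <= x) -> omega t <= x.
Proof.
move=> t0 H; rewrite /omega t0; apply: ge_sup; last by move=> _ [j _ <-].
by exists (ln (t ^+ 0 / M 0%N)), 0%N.
Qed.

Lemma omega_ge0 t : 0 <= omega t.
Proof.
case: (ltP 0 t) => t0; last by rewrite /omega ltNge t0.
by apply: le_trans (omega_ge 0 t0); rewrite expr0 LC_0 divr1 ln1.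
Qed.

Lemma omega_small t : t <= 1 -> omega t = 0.
Proof.
move=> t1; apply/eqP; rewrite eq_le omega_ge0 andbT.
case: (ltP 0 t) => t0; last by rewrite /omega ltNge t0.
apply: omega_le => // j; apply: ln_le0.
rewrite ler_pdivrMr ?LC_gt0 // mul1r; apply: le_trans (LC_ge1 j).
by apply: exprn_ile1 => //; exact: ltW.
Qed.

Lemma omega_nondecr s t : s <= t -> omega s <= omega t.
Proof.
case: (ltP 0 s) => s0 st; last by rewrite {1}/omega ltNge s0 omega_ge0.
have t0 := lt_le_trans s0 st.
apply: omega_le => // j; apply: le_trans (omega_ge j t0).
rewrite ler_ln ?posrE ?divr_gt0 ?exprn_gt0 ?LC_gt0 //.
rewrite ler_pM2r ?invr_gt0 ?LC_gt0 //.
by apply: lerXn2r; rewrite // nnegrE ltW.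
Qed.

Lemma omega_lip (T : R) : exists J : nat, forall s t, 0 < s -> s <= t -> t <= T ->
  omega t <= omega s + J%:R * (ln t - ln s).
Proof.
have [J HJ] := LC_large T; exists J => s t s0 st tT.
have t0 := lt_le_trans s0 st.
have lst : 0 <= ln t - ln s by rewrite subr_ge0 ler_ln.
apply: omega_le => // j; have [Jj|jJ] := leqP J j.
  apply: le_trans (HJ _ _ t0 tT Jj) _.
  by rewrite addr_ge0 ?omega_ge0 // mulr_ge0.
apply: (@le_trans _ _ (ln (s ^+ j / M j) + j%:R * (ln t - ln s))).
  rewrite !ln_div ?posrE ?exprn_gt0 ?LC_gt0 // !lnXn //.
  by rewrite mulrBr !mulr_natl addrAC [X in _ <= X - _]addrC subrK.
by apply: lerD (omega_ge _ s0) _; rewrite ler_wpM2r // ler_nat ltnW.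
Qed.

Lemma omega_continuous : continuous omega.
Proof.
move=> a; have [a1|a1] := ltP a 1.
  rewrite /continuous_at omega_small ?ltW //; apply: cvg_near_cst.
  near=> t; apply/omega_small/ltW; near: t; exact: lt_nbhsl.
have a0 : 0 < a by apply: lt_le_trans a1.
have [J HJ] := omega_lip (a + 1).
have lna : `|ln t - ln a| @[t --> a] --> 0.
  apply/norm_cvg0P.
  have := cvgB (continuous_ln a0) (cvg_cst (ln a)).
  by rewrite subrr; exact.
apply: (@squeeze_cvgr _ _ _ _ (fun t => omega a - J%:R * `|ln t - ln a|)
   (fun t => omega a + J%:R * `|ln t - ln a|)).
- near=> t.
  have t0 : 0 < t by near: t; exact: lt_nbhsr.
  have ta : t <= a + 1.
    by apply/ltW; near: t; apply: lt_nbhsl; rewrite ltrDl.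
  have [ta'|at'] := leP t a.
    have la : ln t <= ln a by rewrite ler_ln.
    rewrite ler0_norm ?subr_le0 // opprB lerBlDr HJ ?lerDl //=.
    apply: le_trans (omega_nondecr ta') _.
    by rewrite lerDl mulr_ge0 // subr_ge0.
  have la : ln a <= ln t by rewrite ler_ln // ltW.
  rewrite ger0_norm ?subr_ge0 // HJ ?(ltW at') // andbT lerBlDr.
  apply: le_trans (omega_nondecr (ltW at')) _.
  by rewrite lerDl mulr_ge0 // subr_ge0.
- have := cvgB (cvg_cst (omega a)) (@cvgMl_tmp _ _ _ _ _ J%:R _ lna).
  by rewrite mulr0 subr0; exact.
- have := cvgD (cvg_cst (omega a)) (@cvgMl_tmp _ _ _ _ _ J%:R _ lna).
  by rewrite mulr0 addr0; exact.
Unshelve. all: by end_near. Qed.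

Variable c : {posnum R}.

Let vMc_fun t : R := expR (- (c%:num * omega t)).

Lemma vMc_continuous : {within `[0, +oo[, continuous vMc_fun}.
Proof.
apply: continuous_subspaceT => t.
apply: continuous_comp; last exact: continuous_expR.
by apply: cvgN; apply: cvgMl_tmp; exact: omega_continuous.
Qed.

Lemma vMc_nonincr s t : 0 <= s -> s <= t -> vMc_fun t <= vMc_fun s.
Proof.
by move=> _ st; rewrite /vMc_fun ler_expR lerN2 ler_pM2l // omega_nondecr.
Qed.

Lemma vMc_decay (k : nat) : t ^+ k * vMc_fun t @[t --> +oo] --> 0.
Proof.
pose j := Num.Def.archi_bound (k.+1%:R / c%:num).
have kj : k.+1%:R <= c%:num * j%:R.
  rewrite mulrC -ler_pdivrMr //; apply/ltW.
  by apply: archi_boundP; rewrite divr_ge0.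
apply: (@squeeze_cvgr _ _ _ _ (fun=> 0) (fun t => (M j `^ c%:num) * t^-1)).
- near=> t.
  have t1 : 1 <= t by near: t; apply: nbhs_pinfty_ge; rewrite num_real.
  have t0 : 0 < t by apply: lt_le_trans t1.
  rewrite mulr_ge0 ?expR_ge0 ?exprn_ge0 ?(ltW t0) //=.
  rewrite ler_pdivlMr // mulrAC -exprSr.
  have -> : M j `^ c%:num = expR (c%:num * ln (M j)).
    by rewrite /powR gt_eqF ?LC_gt0.
  have -> : t ^+ k.+1 = expR (k.+1%:R * ln t).
    by rewrite expRM_natl lnK // posrE.
  rewrite -expRD ler_expR lerBlDr -mulrDr.
  apply: (@le_trans _ _ (c%:num * (j%:R * ln t))).
    by rewrite mulrA ler_wpM2r // ln_ge0.
  rewrite ler_pM2l // -lerBlDl.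
  apply: le_trans (omega_ge j t0).
  by rewrite ln_div ?posrE ?exprn_gt0 ?LC_gt0 // lnXn // mulr_natl.
- exact: cvg_cst.
- rewrite -(mulr0 (M j `^ c%:num)); apply: cvgMl_tmp.
  apply/gtr0_cvgV0; last exact: cvg_id.
  by near=> t; near: t; apply: nbhs_pinfty_gt; rewrite num_real.
Unshelve. all: by end_near. Qed.

Definition vMc : weight R := Weight vMc_continuous vMc_nonincr
  (fun t _ => expR_gt0 _) vMc_decay.

End associated_weight.

Section weighted_entire.
Context (R : realType).
Notation C := (R[i]^o).
Implicit Types (v : weight R) (f : C -> C).

(* The base field of derivable is R[i] here, so this is complex
   differentiability. *)
Definition entire f := forall z : C, derivable f z 1.

(* Normc.normc is the R-valued modulus on R[i]: `|z| = (Normc.normc z)%:C. *)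
Definition wrange v f : set R :=
  range (fun z : C => Normc.normc (f z) * v (Normc.normc z)).

Definition in_Hinf v : {pred C -> C} :=
  mem [set f | entire f /\ has_ubound (wrange v f)].

Lemma in_HinfP v f : f \in in_Hinf v <-> entire f /\ has_ubound (wrange v f).
Proof. by rewrite inE. Qed.

Record Hinf v := MkHinf { Hinf_fun :> C -> C; _ : Hinf_fun \in in_Hinf v }.

Lemma normc_ge0 (z : R[i]) : 0 <= Normc.normc z.
Proof. by case: z => a b; exact: sqrtr_ge0. Qed.

Lemma wterm_ge0 v f (z : C) : 0 <= Normc.normc (f z) * v (Normc.normc z).
Proof. by rewrite mulr_ge0 ?normc_ge0 // ltW // weight_gt0 // normc_ge0. Qed.

Lemma in_Hinf_submod v : submod_closed (in_Hinf v).
Proof.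
split=> [|a f g /in_HinfP[ef [A fA]] /in_HinfP[eg [B gB]]]; apply/in_HinfP.
  split; first by move=> z; exact: derivable_cst.
  exists 0 => _ [z _ <-].
  by rewrite (_ : Normc.normc _ = 0) ?mul0r //; exact: Normc.normc0.
split; first by move=> z; apply: derivableD => //; exact: derivableZ.
exists (Normc.normc a * A + B) => _ [z _ <-].
apply: (@le_trans _ _ ((Normc.normc (a * f z) + Normc.normc (g z)) *
                       v (Normc.normc z))).
  by rewrite ler_wpM2r ?le_normcD // ltW // weight_gt0 // normc_ge0.
rewrite Normc.normcM mulrDl -mulrA lerD //; last by apply: gB; exists z.
by rewrite ler_wpM2l ?normc_ge0 //; apply: fA; exists z.
Qed.

HB.instance Definition _ v :=
  GRing.isSubmodClosed.Build _ _ (in_Hinf v) (in_Hinf_submod v).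
HB.instance Definition _ v := [isSub for @Hinf_fun v].
HB.instance Definition _ v := [Choice of Hinf v by <:].
HB.instance Definition _ v := [SubChoice_isSubLmodule of Hinf v by <:].

(* Normed modules over R[i] carry an R[i]-valued norm, hence the cast. *)
Definition Hinf_norm v (f : Hinf v) : R[i] := (sup (wrange v f))%:C.

Lemma Hinf_supP v (f : Hinf v) : has_sup (wrange v f).
Proof.
case: f => f /= /in_HinfP[_ fb]; split=> //.
by exists (Normc.normc (f 0) * v (Normc.normc 0)), 0.
Qed.

Lemma Hinf_sup_ge v (f : Hinf v) (z : C) :
  Normc.normc (f z) * v (Normc.normc z) <= sup (wrange v f).
Proof. by apply: (sup_upper_bound (Hinf_supP f)); exists z. Qed.

Lemma Hinf_sup_le v (f : Hinf v) x :
  (forall z : C, Normc.normc (f z) * v (Normc.normc z) <= x) ->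
  sup (wrange v f) <= x.
Proof.
move=> H; apply: ge_sup; last by move=> _ [z _ <-].
by case: (Hinf_supP f).
Qed.

Lemma Hinf_normD v (f g : Hinf v) :
  Hinf_norm (f + g) <= Hinf_norm f + Hinf_norm g.
Proof.
rewrite /Hinf_norm -rmorphD /= lecR; apply: (@Hinf_sup_le v (f + g)) => z.
have vz : 0 <= v (Normc.normc z) by rewrite ltW // weight_gt0 // normc_ge0.
apply: (@le_trans _ _ ((Normc.normc (f z) + Normc.normc (g z)) *
                       v (Normc.normc z))).
  by rewrite ler_wpM2r // le_normcD.
by rewrite mulrDl lerD // Hinf_sup_ge.
Qed.

Lemma Hinf_sup_Zle v (a : R[i]) (f : Hinf v) :
  sup (wrange v (a *: f)) <= Normc.normc a * sup (wrange v f).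
Proof.
apply: Hinf_sup_le => z.
rewrite (_ : (a *: f) z = a * f z) // Normc.normcM -mulrA.
by rewrite ler_wpM2l ?normc_ge0 // Hinf_sup_ge.
Qed.

Lemma Hinf_normZ v (a : R[i]) (f : Hinf v) :
  Hinf_norm (a *: f) = `|a| * Hinf_norm f.
Proof.
rewrite (_ : `|a| = (Normc.normc a)%:C) // /Hinf_norm -rmorphM /=.
congr (_%:C); apply/eqP; rewrite eq_le Hinf_sup_Zle /=.
have [->|a0] := eqVneq a 0.
  rewrite Normc.normc0 mul0r; apply: (le_trans _ (Hinf_sup_ge (0 *: f) 0)).
  exact: wterm_ge0.
rewrite mulrC -ler_pdivlMr; last first.
  rewrite lt_neqAle normc_ge0 andbT eq_sym.
  by apply: contra a0 => /eqP/Normc.eq0_normc ->.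
have := Hinf_sup_Zle a^-1 (a *: f).
by rewrite scalerA mulVf // scale1r Normc.normcV mulrC.
Qed.

Lemma Hinf_norm0_eq0 v (f : Hinf v) : Hinf_norm f = 0 -> f = 0.
Proof.
move=> /(congr1 (@complex.Re R)) /= f0; apply/val_inj/funext => z /=.
apply: Normc.eq0_normc; apply/eqP; rewrite eq_le normc_ge0 andbT.
have := Hinf_sup_ge f z; rewrite f0 -[X in _ <= X -> _](mul0r (v (Normc.normc z))).
by rewrite ler_pM2r // weight_gt0 // normc_ge0.
Qed.

HB.instance Definition _ v := Lmodule_isNormed.Build R[i] (Hinf v)
  (@Hinf_normD v) (@Hinf_normZ v) (@Hinf_norm0_eq0 v).

End weighted_entire.

Record weight_seq (R : realType) := MkWeightSeq {
  wseq :> nat -> weight R;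
  wseq_decr : forall n t, 0 <= t -> wseq n.+1 t <= wseq n t }.

Section inductive_limit.
Context (R : realType) (w : weight_seq R).
Notation C := (R[i]^o).

Definition in_Hind : {pred C -> C} := mem (\bigcup_n [set` in_Hinf (w n)]).

Lemma in_HindP (f : C -> C) : f \in in_Hind <-> exists n, f \in in_Hinf (w n).
Proof. by rewrite inE; split=> [[n _ fn]|[n fn]]; exists n. Qed.

Lemma wseq_le m n t : 0 <= t -> (m <= n)%N -> w n t <= w m t.
Proof.
move=> t0 /subnK <-; elim: (n - m)%N => [|k IH]; first by rewrite add0n.
by rewrite addSn (le_trans _ IH) // wseq_decr.
Qed.

Lemma in_Hinf_mono m n (f : C -> C) :
  (m <= n)%N -> f \in in_Hinf (w m) -> f \in in_Hinf (w n).
Proof.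
move=> mn /in_HinfP[ef [A fA]]; apply/in_HinfP; split=> //.
exists A => _ [z _ <-]; apply: le_trans (fA _ _); last by exists z.
by rewrite ler_wpM2l ?normc_ge0 // wseq_le // normc_ge0.
Qed.

Record Hind := MkHind { Hind_fun :> C -> C; _ : Hind_fun \in in_Hind }.

Lemma in_Hind_submod : submod_closed in_Hind.
Proof.
split; first by apply/in_HindP; exists 0%N; exact: rpred0.
move=> a f g /in_HindP[m fm] /in_HindP[n gn].
apply/in_HindP; exists (maxn m n); apply: rpredD.
  by apply: rpredZ; apply: in_Hinf_mono fm; exact: leq_maxl.
by apply: in_Hinf_mono gn; exact: leq_maxr.
Qed.

HB.instance Definition _ :=
  GRing.isSubmodClosed.Build _ _ in_Hind in_Hind_submod.
HB.instance Definition _ := [isSub for Hind_fun].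
HB.instance Definition _ := [Choice of Hind by <:].
HB.instance Definition _ := [SubChoice_isSubLmodule of Hind by <:].

Lemma Hind_incl_subproof n (f : Hinf (w n)) : (f : C -> C) \in in_Hind.
Proof. by apply/in_HindP; exists n; case: f. Qed.

Definition Hind_incl n (f : Hinf (w n)) : Hind := MkHind (Hind_incl_subproof f).

Lemma Hind_incl_linear n : linear (@Hind_incl n).
Proof. by move=> a f g; apply/val_inj. Qed.

HB.instance Definition _ n :=
  GRing.isLinear.Build R[i] (Hinf (w n)) Hind _ (@Hind_incl n)
    (@Hind_incl_linear n).

Lemma Hind_inclP (f : Hind) : exists n (g : Hinf (w n)), Hind_incl g = f.
Proof.
case: f => f fP; have /in_HindP[n fn] := fP.
by exists n, (MkHinf fn); apply/val_inj.
Qed.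

Definition abs_convex (E : lmodType R[i]) (V : set E) :=
  forall (x y : E) (a b : R[i]),
    V x -> V y -> `|a| + `|b| <= 1 -> V (a *: x + b *: y).

(* The locally convex inductive limit topology on the union of the steps: its
   0-neighbourhoods are generated by the absolutely convex sets whose trace on
   every step is a 0-neighbourhood. Hind_universal below characterises it as
   the finest locally convex topology making all inclusions continuous. *)
Definition Hind_base : set (set Hind) := [set V | abs_convex V /\
  forall n, nbhs (0 : Hinf (w n)) (@Hind_incl n @^-1` V)].

Definition Hind_nbhs (f : Hind) : set_system Hind :=
  filter_from Hind_base (fun V => [set g | V (g - f)]).

Lemma Hind_base0 V : Hind_base V -> V 0.
Proof. by move=> [_ /(_ 0%N)/nbhs_singleton]; rewrite /= linear0. Qed.

Lemma Hind_baseZ V a : Hind_base V -> Hind_base [set x | V (a *: x)].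
Proof.
move=> [Vc Vn]; split=> [x y b c Vx Vy bc|n] /=.
  rewrite scalerDr !scalerA ![a * _]mulrC -!scalerA; exact: Vc.
have -> : @Hind_incl n @^-1` [set x | V (a *: x)] =
    ( *:%R a) @^-1` (@Hind_incl n @^-1` V).
  by apply/funext => f /=; rewrite linearZ.
by apply: (@scaler_continuous _ (Hinf (w n)) a 0); rewrite scaler0; exact: Vn.
Qed.

Lemma Hind_base_bal V a x : Hind_base V -> `|a| <= 1 -> V x -> V (a *: x).
Proof.
move=> BV a1 Vx; rewrite -[_ *: _]addr0 -(scaler0 _ (0 : R[i])).
by apply: BV.1 => //; [exact: Hind_base0|rewrite normr0 addr0].
Qed.

Lemma Hind_baseD V x y : Hind_base V -> V (2%:R *: x) -> V (2%:R *: y) -> V (x + y).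
Proof.
move=> [Vc _] Vx Vy; have /= := Vc _ _ 2%:R^-1 2%:R^-1 Vx Vy.
rewrite !scalerA mulVf ?pnatr_eq0 // !scale1r; apply.
by rewrite ger0_norm ?invr_ge0 ?ler0n // -(mul1r 2%:R^-1) -splitr.
Qed.

Lemma Hind_base_abs V x : Hind_base V -> exists2 r : R[i], 0 < r & V (r *: x).
Proof.
move=> [_ Vn]; have [n [f <-]] := Hind_inclP x.
have /nbhs_normP[e /= e0 eV] := Vn n.
have f1 : 0 < `|f| + 1 by rewrite ltr_wpDl.
exists (e / (`|f| + 1)); first by rewrite divr_gt0.
rewrite -linearZ; apply: eV => /=.
rewrite sub0r normrN normrZ ger0_norm ?divr_ge0 ?ltW //.
by rewrite mulrAC ltr_pdivrMr // ltr_pM2l // ltrDl.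
Qed.

Lemma Hind_nbhs_filter f : ProperFilter (Hind_nbhs f).
Proof.
apply: filter_from_proper; last first.
  by move=> V BV; exists f; rewrite /= subrr; exact: Hind_base0.
apply: filter_from_filter.
  exists setT; split; first by [].
  by move=> n; exact: filterT.
move=> U V BU BV; exists (U `&` V) => //; split.
  by move=> x y a b [Ux Vx] [Uy Vy] ab; split; [exact: BU.1|exact: BV.1].
by move=> n; apply: filterI; [exact: BU.2|exact: BV.2].
Qed.

Lemma Hind_nbhs_singleton f A : Hind_nbhs f A -> A f.
Proof. by move=> [V BV]; apply; rewrite /= subrr; exact: Hind_base0. Qed.

Lemma Hind_nbhs_nbhs f A : Hind_nbhs f A -> Hind_nbhs f (Hind_nbhs^~ A).
Proof.
move=> [V BV VA]; have BW := Hind_baseZ 2%:R BV.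
exists [set x | V (2%:R *: x)] => // g /= Vg.
exists [set x | V (2%:R *: x)] => // h /= Vh.
by apply: VA => /=; rewrite -(subrK g h) -addrA; exact: Hind_baseD.
Qed.

HB.instance Definition _ := hasNbhs.Build Hind Hind_nbhs.
HB.instance Definition _ := Nbhs_isNbhsTopological.Build Hind
  Hind_nbhs_filter Hind_nbhs_singleton Hind_nbhs_nbhs.

Lemma Hind_add_continuous : continuous (fun x : Hind * Hind => x.1 + x.2).
Proof.
move=> [f g] A [V BV VA]; have BW := Hind_baseZ 2%:R BV.
exists ([set h | V (2%:R *: (h - f))], [set h | V (2%:R *: (h - g))]).
  by split; exists [set x | V (2%:R *: x)].
move=> [f' g'] [/= Vf Vg]; apply: VA => /=.
by rewrite opprD addrACA; exact: Hind_baseD.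
Qed.

Lemma Hind_scale_continuous :
  continuous (fun z : R[i]^o * Hind => z.1 *: z.2).
Proof.
move=> [k x] A [V BV VA]; have [r r0 Vr] := Hind_base_abs x BV.
pose s := 2%:R * (`|k| + r).
have kr : 0 < `|k| + r by rewrite ltr_wpDl.
exists ([set k' | `|k - k'| < r / 2%:R], [set h | V (s *: (h - x))]).
  split; last by exists [set x | V (s *: x)] => //; exact: Hind_baseZ.
  by exists (r / 2%:R) => //=; rewrite divr_gt0.
move=> [k' x'] [/= kk Vx]; apply: VA => /=.
have -> : k' *: x' - k *: x = k' *: (x' - x) + (k' - k) *: x.
  by rewrite scalerBr scalerBl addrA subrK.
apply: Hind_baseD => //.
  have -> : 2%:R *: (k' *: (x' - x)) =
            (k' / (`|k| + r)) *: (s *: (x' - x)).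
    rewrite !scalerA; congr (_ *: _); rewrite /s.
    by rewrite mulrCA divfK ?gt_eqF.
  apply: Hind_base_bal => //.
  rewrite normrM normfV (ger0_norm (ltW kr)) ler_pdivrMr // mul1r.
  rewrite -[k'](subKr k); apply: le_trans (ler_normB _ _) _.
  rewrite lerD2l; apply: le_trans (ltW kk) _.
  by rewrite ler_pdivrMr // ler_peMr ?ltW // ltr1n.
have -> : 2%:R *: ((k' - k) *: x) = (2%:R * (k' - k) / r) *: (r *: x).
  by rewrite !scalerA divfK ?gt_eqF.
apply: Hind_base_bal => //.
rewrite !normrM normfV (ger0_norm (ltW r0)) ger0_norm ?ler0n //.
by rewrite ler_pdivrMr // mul1r mulrC -ler_pdivlMr // distrC ltW.
Qed.

Lemma Hind_locally_convex : exists2 B : set_system Hind,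
  (forall b, b \in B -> convex_set b) & basis B.
Proof.
exists [set b | open b /\ convex_set b] => [b|]; first by rewrite inE => -[].
split=> [b []//|f A [V BV VA]].
exists (interior [set g | V (g - f)]); last first.
  by move=> g /interior_subset /VA.
split; last by exists V.
split; first exact: open_interior.
move=> x y l; rewrite !inE => xA yA.
have [U BU Ux] : Hind_nbhs x [set g | V (g - f)] := xA.
have [W BW Wy] : Hind_nbhs y [set g | V (g - f)] := yA.
pose c : Hind := l%:num *: x + (1 - l%:num) *: y.
suff : Hind_nbhs c [set g | V (g - f)] by [].
exists (U `&` W).
  split; last by move=> n; apply: filterI; [exact: BU.2|exact: BW.2].
  by move=> p q a b [? ?] [? ?] ab; split; [exact: BU.1|exact: BW.1].
move=> z [/= Uz Wz].
have l01 (h : Hind) : l%:num *: h + (1 - l%:num) *: h = h.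
  by rewrite -scalerDl addrC subrK scale1r.
have -> : z - f = l%:num *: ((x + (z - c)) - f)
                  + (1 - l%:num) *: ((y + (z - c)) - f).
  have e (h : Hind) : h + (z - c) - f = h + (z - f - c).
    by rewrite -addrA [z - f - c]addrAC.
  by rewrite !e !scalerDr addrACA -!scalerDr l01 -/c addrC subrK.
apply: BV.1; [apply: Ux|apply: Wy|].
- by rewrite /= [x + _]addrC addrK.
- by rewrite /= [y + _]addrC addrK.
- by rewrite !ger0_norm ?subr_ge0 // addrC subrK.
Qed.

HB.instance Definition _ := PreTopologicalLmod_isTvs.Build R[i] Hind
  Hind_add_continuous Hind_scale_continuous Hind_locally_convex.
HB.instance Definition _ :=
  PreTopologicalNmodule_isTopologicalNmodule.Build Hind Hind_add_continuous.
HB.instance Definition _ :=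
  TopologicalNmodule_isTopologicalLmodule.Build R[i] Hind Hind_scale_continuous.
HB.instance Definition _ := Uniform_isTvs.Build R[i] Hind Hind_locally_convex.

End inductive_limit.

Section inductive_limit_theory.
Context (R : realType) (w : weight_seq R).

Lemma Hind_incl_continuous n : continuous (@Hind_incl R w n).
Proof.
move=> f A [V [_ Vn] VA].
have : nbhs f [set g : Hinf (w n) | V (Hind_incl (g - f))].
  have := @sub_continuous (Hinf (w n)) (f, f).
  rewrite /continuous_at subrr => /(_ _ (Vn n))[[A1 A2] /= [A1f A2f] AA].
  apply: filterS A1f => g A1g; apply: (AA (g, f)); split=> //=.
  exact: nbhs_singleton.
by apply: filterS => g Vg; apply: VA => /=; rewrite -linearB.
Qed.

Lemma Hind_universal (F : tvsType R[i]) (T : {linear Hind w -> F}) :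
  continuous T <-> forall n, continuous (T \o @Hind_incl R w n).
Proof.
split=> [Tc n f|Tc f A].
  by apply: continuous_comp; [exact: Hind_incl_continuous|exact: Tc].
move=> nA; have [B Bc Bb] := @locally_convex _ F.
have n0 : nbhs (0 : F) [set x | A (T f + x)].
  have /= := @add_continuous F (T f, 0) A.
  rewrite addr0 => /(_ nA)[[A1 A2] /= [A1f A20] AA].
  apply: filterS A20 => x A2x; apply: (AA (T f, x)); split=> //=.
  exact: nbhs_singleton.
have [U [BU U0] UA] := Bb.2 0 _ n0.
pose V := [set x : F | forall a : R[i], `|a| <= 1 -> U (a *: x)].
have nV : nbhs (0 : F) V.
  have /= := @scale_continuous _ F (0, 0) U.
  rewrite scaler0 => /(_ (open_nbhs_nbhs (conj (Bb.1 _ BU) U0))).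
  move=> [[A1 A2] /= [[e /= e0 A1e] A20] AA].
  have e2 : e / 2%:R != 0 by rewrite mulf_neq0 ?invr_eq0 ?gt_eqF.
  have := nbhs0Z e2 A20; apply: filterS => _ [x A2x <-] a a1.
  rewrite scalerA; apply: (AA (a * (e / 2%:R), x)); split=> //=.
  apply: A1e; rewrite /= sub0r normrN normrM.
  have ee : `|e / 2%:R| < e.
    by rewrite ger0_norm ?divr_ge0 ?ltW // ltr_pdivrMr // ltr_pMr // ltr1n.
  by apply: le_lt_trans ee; rewrite ler_piMl.
exists (T @^-1` V); last first.
  move=> g /= /(_ 1); rewrite normr1 => /(_ (lexx _)); rewrite scale1r => /UA /=.
  by rewrite linearB addrC subrK.
split; last first.
  by move=> n; have := Tc n 0 V; rewrite /= !linear0; apply.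
move=> x y a b Vx Vy ab c c1 /=.
have Uc (p q : F) (l : R[i]) : 0 <= l -> l <= 1 -> U p -> U q ->
    U (l *: p + (1 - l) *: q).
  move=> l0 l1 Up Uq; have := Bc U _ p q (Itv01 l0 l1).
  by rewrite !inE; exact.
pose t := `|a| + `|b|; have t0 : 0 <= t by rewrite addr_ge0.
have [tE|tn0] := eqVneq t 0.
  have := tE; rewrite /t => /eqP; rewrite paddr_eq0 // !normr_eq0.
  by move=> /andP[/eqP-> /eqP->]; rewrite !scale0r addr0 linear0 scaler0.
have tp : 0 < t by rewrite lt_neqAle eq_sym tn0.
have sgn (d : R[i]) : `|d / `|d| | <= 1.
  have [->|d0] := eqVneq d 0; first by rewrite mul0r normr0.
  by rewrite normrM normfV normr_id divff // normr_eq0.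
have sgnE (d : R[i]) : d = `|d| / t * (t * (d / `|d|)).
  have [->|d0] := eqVneq d 0; first by rewrite normr0 !mul0r.
  by rewrite mulrA divfK // mulrCA divff ?mulr1 // normr_eq0.
have le1 (d : R[i]) : `|c * (t * (d / `|d|))| <= 1.
  rewrite !normrM (ger0_norm t0) -[leRHS]mulr1; apply: ler_pM => //.
    by rewrite -normrM mulr_ge0.
  by rewrite -[leRHS]mulr1 -normrM; apply: ler_pM.
have E (d : R[i]) p : c *: (d *: p) =
    (`|d| / t) *: ((c * (t * (d / `|d|))) *: p) :> F.
  by rewrite !scalerA {1}(sgnE d) mulrCA.
rewrite linearD !linearZ /= scalerDr !E.
have -> : `|b| / t = 1 - `|a| / t.
  by rewrite -[1](divff tn0) -mulrBl /t addrC addrK.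
apply: Uc; [by rewrite divr_ge0| |exact: Vx|exact: Vy].
by rewrite ler_pdivrMr // mul1r lerDl.
Qed.

End inductive_limit_theory.

Section projective_limit.
Context (R : realType) (u : nat -> weight R).
Notation C := (R[i]^o).

Definition in_Hproj : {pred C -> C} := mem (\bigcap_n [set` in_Hinf (u n)]).

Lemma in_HprojP (f : C -> C) : f \in in_Hproj <-> forall n, f \in in_Hinf (u n).
Proof. by rewrite inE; split=> [fu n|fu n _]; exact: fu. Qed.

Record Hproj := MkHproj { Hproj_fun :> C -> C; _ : Hproj_fun \in in_Hproj }.

Lemma in_Hproj_submod : submod_closed in_Hproj.
Proof.
split; first by apply/in_HprojP => n; exact: rpred0.
move=> a f g /in_HprojP fu /in_HprojP gu.
by apply/in_HprojP => n; apply: rpredD; [apply: rpredZ; exact: fu|exact: gu].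
Qed.

HB.instance Definition _ :=
  GRing.isSubmodClosed.Build _ _ in_Hproj in_Hproj_submod.
HB.instance Definition _ := [isSub for Hproj_fun].
HB.instance Definition _ := [Choice of Hproj by <:].
HB.instance Definition _ := [SubChoice_isSubLmodule of Hproj by <:].

Lemma Hproj_proj_subproof n (f : Hproj) : (f : C -> C) \in in_Hinf (u n).
Proof. by case: f => f /= /in_HprojP. Qed.

Definition Hproj_proj n (f : Hproj) : Hinf (u n) :=
  MkHinf (Hproj_proj_subproof n f).

Lemma Hproj_proj_linear n : linear (Hproj_proj n).
Proof. by move=> a f g; apply/val_inj. Qed.

HB.instance Definition _ n :=
  GRing.isLinear.Build R[i] Hproj (Hinf (u n)) _ (Hproj_proj n)
    (@Hproj_proj_linear n).

(* The coarsest topology making all the inclusions Hproj_proj n continuous. *)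
Definition Hproj_topology : Type :=
  sup_topology (fun n => Topological.class (initial_topology (Hproj_proj n))).

HB.instance Definition _ := Topological.copy Hproj Hproj_topology.

Lemma Hproj_cvg (F : set_system Hproj) (f : Hproj) : Filter F ->
  F --> f <-> forall n, Hproj_proj n @ F --> Hproj_proj n f.
Proof.
move=> FF; split=> [Ff n A nA|H].
  have /cvg_sup/(_ n) := Ff; apply; exact: initial_continuous nA.
apply/cvg_sup => n A; rewrite nbhsE => -[_ [[B oB <-] Bf] BA].
by apply: (filterS BA); apply: H; exact: open_nbhs_nbhs.
Qed.

Lemma Hproj_universal (T : topologicalType) (g : T -> Hproj) :
  continuous g <-> forall n, continuous (Hproj_proj n \o g).
Proof.
split=> [gc n t|gc t]; last by apply/Hproj_cvg => n; exact: gc.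
by have /Hproj_cvg/(_ n) := gc t.
Qed.

Lemma Hproj_proj_continuous n : continuous (Hproj_proj n).
Proof. by apply: (Hproj_universal id).1 => f; exact: cvg_id. Qed.

Lemma Hproj_add_continuous : continuous (fun x : Hproj * Hproj => x.1 + x.2).
Proof.
apply/Hproj_universal => n [f g].
have -> : Hproj_proj n \o (fun x : Hproj * Hproj => x.1 + x.2) =
    fun x => Hproj_proj n x.1 + Hproj_proj n x.2.
  by apply/funext => x /=; rewrite linearD.
by apply: cvgD; apply: continuous_comp;
  [exact: cvg_fst|exact: Hproj_proj_continuous|
   exact: cvg_snd|exact: Hproj_proj_continuous].
Qed.

Lemma Hproj_scale_continuous :
  continuous (fun z : R[i]^o * Hproj => z.1 *: z.2).
Proof.
apply/Hproj_universal => n [k f].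
have -> : Hproj_proj n \o (fun z : R[i]^o * Hproj => z.1 *: z.2) =
    fun z => z.1 *: Hproj_proj n z.2.
  by apply/funext => x /=; rewrite linearZ.
apply: cvgZ; first exact: cvg_fst.
by apply: continuous_comp; [exact: cvg_snd|exact: Hproj_proj_continuous].
Qed.

Lemma Hproj_locally_convex : exists2 B : set_system Hproj,
  (forall b, b \in B -> convex_set b) & basis B.
Proof.
exists [set b | open b /\ convex_set b] => [b|]; first by rewrite inE => -[].
split=> [b []//|f].
set G := filter_from _ _.
have GF : Filter G.
  apply: filter_from_filter.
    exists setT => //; split=> //; split; first exact: openT.
    by move=> *; rewrite inE.
  move=> P Q [[oP cP] Pf] [[oQ cQ] Qf]; exists (P `&` Q) => //; split=> //.
  split; first exact: openI.
  move=> x y l; rewrite !inE => -[Px Qx] [Py Qy]; split.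
    by apply/set_mem/cP; rewrite inE.
  by apply/set_mem/cQ; rewrite inE.
apply/Hproj_cvg => n A nA; have [B Bc Bb] := @locally_convex _ (Hinf (u n)).
have [U [BU Uf] UA] := Bb.2 _ _ nA.
exists (Hproj_proj n @^-1` U); last by move=> g /UA.
split=> //; split.
  by apply: open_comp (Bb.1 _ BU) => x _; exact: Hproj_proj_continuous.
move=> x y l; rewrite !inE => Ux Uy.
have := Bc U _ (Hproj_proj n x) (Hproj_proj n y) l; rewrite !inE.
move=> /(_ BU Ux Uy) Ul.
suff : U (Hproj_proj n (l%:num *: x + (1 - l%:num) *: y)) by [].
by rewrite linearD !linearZ.
Qed.

HB.instance Definition _ := PreTopologicalLmod_isTvs.Build R[i] Hproj
  Hproj_add_continuous Hproj_scale_continuous Hproj_locally_convex.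
HB.instance Definition _ :=
  PreTopologicalNmodule_isTopologicalNmodule.Build Hproj Hproj_add_continuous.
HB.instance Definition _ :=
  TopologicalNmodule_isTopologicalLmodule.Build R[i] Hproj Hproj_scale_continuous.
HB.instance Definition _ := Uniform_isTvs.Build R[i] Hproj Hproj_locally_convex.
End projective_limit.

Section class_weights.
Context (R : realType).
Implicit Type M : LC R.

Lemma vMc_anti M (a b : {posnum R}) t : a%:num <= b%:num ->
  vMc M b t <= vMc M a t.
Proof. by move=> ab; rewrite ler_expR lerN2 ler_wpM2r // omega_ge0. Qed.

Definition vM M : weight R := vMc M 1%:pos.

(* Exponents range over c >= 1, so the n-th entry has c = n.+1. *)
Definition under_fun M (n : nat) : weight R := vMc M (n.+1%:R)%:pos.

Lemma under_fun_decr M n t : 0 <= t -> under_fun M n.+1 t <= under_fun M n t.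
Proof. by move=> _; apply: vMc_anti; rewrite /= ler_nat. Qed.

Definition under_seq M : weight_seq R := MkWeightSeq (@under_fun_decr M).

Definition over_seq M (n : nat) : weight R := vMc M (n.+1%:R^-1)%:pos.

Definition weight_prec (v w : weight R) : Prop :=
  exists c C : R, [/\ 1 <= c, 1 <= C &
    forall t, 0 <= t -> w t `^ c <= C * v t].

Definition weight_sim (v w : weight R) : Prop :=
  weight_prec v w /\ weight_prec w v.

End class_weights.

Section comparison.
Context (T : Type) (X Y : topologicalType) (iX : X -> T) (iY : Y -> T).

(* X and Y stand for the subspaces iX(X), iY(Y) of T; iX and iY are injective
   in all uses. *)
Definition continuous_inclusion : Prop :=
  exists2 j : X -> Y, (forall x, iY (j x) = iX x) & continuous j.

(* When the linear structures are both inherited from T, this is equality as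
   topological vector spaces. *)
Definition same_space : Prop :=
  range iX = range iY /\
  forall U : set T, open (iX @^-1` U) <-> open (iY @^-1` U).

End comparison.

(* Main.v *)
Require Import Defs.
From HB Require Import structures.
From mathcomp Require Import all_boot all_order all_algebra.
From mathcomp Require Import all_classical all_reals all_analysis.
From mathcomp.real_closed Require Import complex.
From mathcomp Require Import ring.
Import Order.TTheory GRing.Theory Num.Theory.
Import numFieldNormedType.Exports.

Local Open Scope classical_set_scope.
Local Open Scope ring_scope.

(** Everything reduces to one comparison, [omega_prec]: omega_M is bounded by a
    multiple of omega_N plus a constant.  Taking logarithms, this is
    v_M <=^c v_N.

    It is also the sequence condition N_j <= A (M_{cj})^{1/c}, because a
    log-convex sequence is recovered from its associated function:
    N_j = max_t t^j exp(- omega_N(t)), the maximum being attained at the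
    quotient t = N_{j+1}/N_j ([omega_attained]).  Conversely the sequence
    condition controls t^k/M_k only at the indices k divisible by c; passing to
    the other indices costs a factor t^c, and t <= N_1 exp(omega_N(t)).

    If [omega_prec] holds, each step of the spaces of M embeds boundedly in a
    step of the spaces of N, which gives both continuous inclusions.

    The converse implications only test the inclusions on monomials, whose
    weighted norms are bounded by roots of the M_j ([monomial_bound]).
    For the projective limits, continuity at 0 bounds the norm of z^j for v_N
    by a constant times its norm for one weight v_M^{1/c}, and this is the
    sequence condition.  For the inductive limits, suppose that
    omega_M(t_n) > (n+1) omega_N(t_n) + n for points t_n > 0.  The functions g
    with |g(t_n)| <= exp((n+1) omega_N(t_n)) for all n form an absolutely convex
    0-neighbourhood of the space of N: on the k-th step the constraints with
    n >= k follow from the norm bound, so only finitely many remain.  By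
    continuity this neighbourhood contains e z^j / M_j for some e > 0 and every
    j; hence omega_M(t_n) <= (n+1) omega_N(t_n) - ln e for all n, which is
    absurd for large n.

    Finally, two subspaces of the same space coincide with their topologies if
    and only if each is continuously included in the other ([same_spaceP]). *)

(** * Log-convex sequences and their associated functions *)

Section associated_function.
Context {R : realType} (M : LC R).
Implicit Types (t x : R) (j k m : nat).

Lemma LC_ratio_nondecr {j k} : (j <= k)%N -> M j.+1 / M j <= M k.+1 / M k.
Proof.
apply: (homo_leq (f := fun i => M i.+1 / M i) (r := <=%R)) => [//|y x z|i].
  exact: le_trans.
rewrite ler_pdivrMr ?LC_gt0 // mulrAC ler_pdivlMr ?LC_gt0 // -expr2 mulrC.
exact: LC_logconvex.
Qed.

Lemma LC_nondecr {j k} : (j <= k)%N -> M j <= M k.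
Proof.
apply: (homo_leq (f := M) (r := <=%R)) => [//|y x z|i]; first exact: le_trans.
rewrite -[X in X <= _]mul1r -ler_pdivlMr ?LC_gt0 //.
by apply: le_trans (LC_ratio_nondecr (leq0n i)); rewrite LC_0 divr1 LC_ge1.
Qed.

Lemma expr_le_omega {t} j : 0 <= t -> t ^+ j <= M j * expR (omega M t).
Proof.
rewrite le_eqVlt => /predU1P[<-|t0].
  rewrite expr0n; case: j => [|j] /=.
    by rewrite LC_0 mul1r -expR0 ler_expR omega_ge0.
  by rewrite mulr_ge0 ?expR_ge0 ?(ltW (LC_gt0 _ _)).
have p0 : 0 < t ^+ j / M j by rewrite divr_gt0 ?exprn_gt0 ?LC_gt0.
rewrite mulrC -ler_pdivrMr ?LC_gt0 // -ler_ln ?posrE ?expR_gt0 // expRK.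
exact: omega_ge.
Qed.

Lemma omega_le_expr t x : 0 < t -> (forall j, t ^+ j <= M j * expR x) ->
  omega M t <= x.
Proof.
move=> t0 H; apply: omega_le => // j.
have p0 : 0 < t ^+ j / M j by rewrite divr_gt0 ?exprn_gt0 ?LC_gt0.
rewrite -[x]expRK ler_ln ?posrE ?expR_gt0 //.
by rewrite ler_pdivrMr ?LC_gt0 // mulrC.
Qed.

(** The quotients of M are nondecreasing, so k |-> t^k / M_k increases up to
    k = j and decreases afterwards as soon as t = M_{j+1} / M_j. *)
Lemma omega_attained j : exists2 t, 0 < t & M j * expR (omega M t) = t ^+ j.
Proof.
pose t := M j.+1 / M j; have t0 : 0 < t by rewrite divr_gt0 ?LC_gt0.
exists t => //; apply/eqP; rewrite eq_le expr_le_omega ?(ltW t0) // andbT.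
have up i : M j * t ^+ i <= M (j + i)%N.
  elim: i => [|i IH]; first by rewrite expr0 mulr1 addn0.
  rewrite exprSr mulrA addnS; apply: le_trans (_ : M (j + i)%N * t <= _).
    by rewrite ler_pM2r.
  by rewrite mulrC -ler_pdivlMr ?LC_gt0 // LC_ratio_nondecr ?leq_addr.
have down i : (i <= j)%N -> M j <= M (j - i)%N * t ^+ i.
  elim: i => [|i IH] ij; first by rewrite subn0 expr0 mulr1.
  apply: le_trans (IH (ltnW ij)) _.
  rewrite exprS mulrA ler_pM2r ?exprn_gt0 // -[(j - i)%N]subSS subSn //.
  by rewrite mulrC -ler_pdivrMr ?LC_gt0 // LC_ratio_nondecr // leq_subr.
have p0 : 0 < t ^+ j / M j by rewrite divr_gt0 ?exprn_gt0 ?LC_gt0.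
suff : omega M t <= ln (t ^+ j / M j).
  by rewrite -ler_expR lnK ?posrE // ler_pdivlMr ?LC_gt0 // mulrC.
apply: omega_le_expr => // k; rewrite lnK ?posrE // mulrA ler_pdivlMr ?LC_gt0 //.
have [jk|/ltnW kj] := leqP j k.
  rewrite -(subnKC jk) exprD -mulrA [leRHS]mulrC ler_pM2l ?exprn_gt0 // mulrC.
  exact: up.
have := down _ (leq_subr k j); rewrite subKn // => dk.
by rewrite -{2}(subnKC kj) exprD mulrA mulrAC mulrC ler_pM2r ?exprn_gt0.
Qed.

End associated_function.

(** * Comparison of the associated functions *)

Lemma exprn_root {R : realType} (y : R) (m : nat) :
  0 <= y -> (0 < m)%N -> (y `^ m%:R^-1) ^+ m = y.
Proof.
move=> y0 m0; rewrite -(powR_mulrn m (powR_ge0 y _)) -powRrM mulVf ?powRr1 //.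
by rewrite pnatr_eq0 -lt0n.
Qed.

(** The multiple is an integer so that it can serve both as the index stretching
    of the sequence condition and as a shift along the steps of the limits. *)
Definition omega_prec {R : realType} (M N : LC R) : Prop :=
  exists (c : nat) (B : R), [/\ (0 < c)%N, 0 <= B &
    forall t, omega M t <= c%:R * omega N t + B].

Section omega_comparison.
Context {R : realType} (M N : LC R).

Lemma weight_precP : weight_prec (vM M) (vM N) <-> omega_prec M N.
Proof.
have E (c B t : R) : 0 < B ->
    (vM N t `^ c <= B * vM M t) = (omega M t <= c * omega N t + ln B).
  move=> B0; rewrite /vM /vMc /= !mul1r -expRM -{1}(lnK B0) -expRD.
  rewrite ler_expR mulNr lerBrDr addrC lerBlDr [_ * c]mulrC.
  by rewrite addrC.
split=> [[c [B [c1 B1 H]]]|[c [B [c0 B0 H]]]].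
  exists (Num.Def.archi_bound c), (ln B).
  have cn := archi_boundP (le_trans ler01 c1).
  split; [|exact: ln_ge0|].
    by rewrite -(ltr_nat R) (lt_trans _ cn) // (lt_le_trans ltr01).
  move=> t; have [t0|t0] := leP 0 t.
    have := H t t0; rewrite E ?(lt_le_trans ltr01) // => /le_trans; apply.
    by rewrite lerD2r ler_wpM2r ?omega_ge0 // ltW.
  rewrite omega_small ?(le_trans (ltW t0)) //.
  by rewrite addr_ge0 ?mulr_ge0 ?omega_ge0 ?ln_ge0.
exists c%:R, (expR B); split=> [||t t0]; first by rewrite ler1n.
  by rewrite -expR0 ler_expR.
by rewrite E ?expR_gt0 // expRK.
Qed.

(** From left to right, evaluate at the point where N_j exp(omega_N) = t^j and
    use the index cj of M.  From right to left, an index k of M is compared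
    with the largest multiple of c up to k. *)
Lemma omega_prec_seqP : omega_prec M N <->
  exists (c : nat) (A : R), [/\ (0 < c)%N, 1 <= A &
    forall j : nat, N j <= A * (M (c * j)%N) `^ (c%:R^-1)].
Proof.
have E (c : nat) (A : R) j : (0 < c)%N -> 0 < A ->
    (N j <= A * (M (c * j)%N) `^ (c%:R^-1)) = (N j ^+ c <= A ^+ c * M (c * j)%N).
  move=> c0 A0; rewrite -(ler_pXn2r c0) ?nnegrE ?(ltW (LC_gt0 N j)) //; last first.
    by rewrite mulr_ge0 ?powR_ge0 ?(ltW A0).
  by rewrite exprMn exprn_root // ltW // LC_gt0.
split=> [[c [B [c0 B0 H]]]|[c [A [c0 A1 H]]]].
  exists c, (expR B); split=> [//||j]; first by rewrite -expR0 ler_expR.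
  rewrite E ?expR_gt0 //.
  have [t t0 tj] := omega_attained N j.
  rewrite -(ler_pM2r (expR_gt0 (c%:R * omega N t))) {1}expRM_natl -exprMn tj.
  rewrite -exprM mulnC; apply: le_trans (expr_le_omega M _ (ltW t0)) _.
  rewrite mulrAC mulrC ler_wpM2r ?(ltW (LC_gt0 _ _)) // -expRM_natl -expRD ler_expR.
  apply: le_trans (H t) _; rewrite addrC lerD2r.
  by rewrite ler_peMl // ler1n.
have A0 := lt_le_trans ltr01 A1.
have N1 : 1 <= N 1%N by exact: LC_ge1.
have NA : 1 <= (N 1%N * A) ^+ c by rewrite exprn_ege1 // mulr_ege1.
(* One c comes from the sequence condition, the other from t^c. *)
exists (2 * c)%N, (ln ((N 1%N * A) ^+ c)); split=> [||t].
- by rewrite muln_gt0.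
- exact: ln_ge0.
have [t1|t1] := leP t 1.
  by rewrite omega_small // addr_ge0 ?mulr_ge0 ?omega_ge0 ?ln_ge0.
have t0 := lt_trans ltr01 t1.
apply: omega_le_expr => // k.
rewrite expRD lnK ?posrE ?(lt_le_trans ltr01) // expRM_natl.
set e := expR (omega N t).
have e0 : 0 <= e by exact: expR_ge0.
apply: (@le_trans _ _ (t ^+ c * (t ^+ (k %/ c)) ^+ c)).
  rewrite {1}(divn_eq k c) exprD exprM mulrC ler_wpM2r ?exprn_ge0 ?(ltW t0) //.
  by rewrite ler_weXn2l ?(ltW t1) // ltnW // ltn_mod.
apply: (@le_trans _ _ ((N 1%N * e) ^+ c * (N (k %/ c)%N * e) ^+ c)).
  have ge0 := mulr_ge0 (ltW (LC_gt0 N _)) e0.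
  apply: ler_pM; rewrite ?exprn_ge0 ?(ltW t0) //.
    rewrite lerXn2r ?nnegrE ?(ltW t0) //.
    by rewrite -[t]expr1 expr_le_omega ?(ltW t0).
  by rewrite lerXn2r ?nnegrE ?exprn_ge0 ?expr_le_omega ?(ltW t0).
have kM : N (k %/ c)%N ^+ c <= A ^+ c * M k.
  have := H (k %/ c)%N; rewrite E // => /le_trans; apply.
  rewrite ler_wpM2l ?exprn_ge0 ?(ltW A0) //.
  by apply: LC_nondecr; rewrite mulnC leq_trunc_div.
have -> : (N 1%N * e) ^+ c * (N (k %/ c)%N * e) ^+ c =
    N (k %/ c)%N ^+ c * (N 1%N ^+ c * e ^+ (2 * c)).
  by rewrite mul2n -addnn exprD !exprMn; ring.
have -> : M k * (e ^+ (2 * c) * (N 1%N * A) ^+ c) =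
    A ^+ c * M k * (N 1%N ^+ c * e ^+ (2 * c)) by rewrite exprMn; ring.
by rewrite ler_wpM2r // mulr_ge0 ?exprn_ge0 // (le_trans ler01).
Qed.

End omega_comparison.

(** * Sufficiency: bounded inclusions between the steps *)

Section inclusions.
Local Open Scope complex_scope.
Context {R : realType}.

(** Replaces the complex-valued norm and its supremum by real pointwise
    bounds, in which all later estimates are made. *)
Lemma nbhs_HinfP (v : weight R) (f : Hinf v) (A : set (Hinf v)) : nbhs f A <->
  exists2 e : R, 0 < e & forall g : Hinf v,
    (forall z, Normc.normc (g z - f z) * v (Normc.normc z) <= e) -> A g.
Proof.
split=> [/nbhs_normP[[e e'] /=]|[e e0 H]].
  rewrite ltcE /= => /andP[/eqP -> e0] H; exists (e / 2%:R).
    by rewrite divr_gt0.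
  move=> g gH; apply: H => /=; rewrite distrC.
  rewrite (_ : `|g - f| = (sup (wrange v (g - f)))%:C) // ltcR.
  apply: (@le_lt_trans _ _ (e / 2%:R)); last first.
    by rewrite ltr_pdivrMr // ltr_pMr // ltr1n.
  by apply: (@Hinf_sup_le _ _ (g - f)) => z; exact: gH.
apply/nbhs_normP; exists e%:C; first by rewrite /= ltcR.
move=> g /=; rewrite distrC.
rewrite (_ : `|g - f| = (sup (wrange v (g - f)))%:C) // ltcR => ge.
by apply: H => z; apply: le_trans (ltW ge); exact: (Hinf_sup_ge (g - f)).
Qed.

Lemma in_Hinf_dominated {v w : weight R} {K : R} {f} :
  (forall t, 0 <= t -> w t <= K * v t) -> f \in in_Hinf v -> f \in in_Hinf w.
Proof.
move=> H /in_HinfP[ef [A fA]]; apply/in_HinfP; split=> //.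
have K0 : 0 <= K.
  rewrite -(pmulr_lge0 _ (weight_gt0 v (lexx 0))).
  by apply: le_trans (H 0 (lexx 0)); rewrite ltW ?weight_gt0.
exists (K * A) => _ [z _ <-].
apply: (@le_trans _ _ (Normc.normc (f z) * (K * v (Normc.normc z)))).
  by rewrite ler_wpM2l ?normc_ge0 // H // normc_ge0.
by rewrite mulrCA ler_wpM2l // fA //; exists z.
Qed.

Lemma vMc_dominated (M N : LC R) (a b : {posnum R}) (c B : R) :
  (forall t, omega M t <= c * omega N t + B) -> a%:num * c <= b%:num ->
  forall t, 0 <= t -> vMc N b t <= expR (a%:num * B) * vMc M a t.
Proof.
move=> H ab t t0; rewrite /vMc /= -expRD ler_expR lerBrDr addrC lerBlDr.
apply: (@le_trans _ _ (a%:num * (c * omega N t + B))); first by rewrite ler_pM2l.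
by rewrite mulrDr mulrA addrC lerD2l ler_wpM2r // omega_ge0.
Qed.

(** The step with exponent n+1 of M goes into the step with exponent c(n+1)
    of N. *)
Lemma omega_prec_Hind (M N : LC R) : omega_prec M N ->
  continuous_inclusion (@Hind_fun R (under_seq M)) (@Hind_fun R (under_seq N)).
Proof.
move=> [c [B [c0 B0 H]]].
have dom n t : 0 <= t ->
    under_seq N (c * n.+1).-1 t <= expR (n.+1%:R * B) * under_seq M n t.
  apply: (@vMc_dominated M N (n.+1%:R)%:pos _ _ _ H) => /=.
  by rewrite prednK ?muln_gt0 ?c0 // natrM mulrC.
have sub (f : Hind (under_seq M)) : (f : _ -> _) \in in_Hind (under_seq N).
  have [n [g <-]] := Hind_inclP f; apply/in_HindP; exists (c * n.+1).-1.
  apply: (in_Hinf_dominated (dom n)); exact: (valP g).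
pose j f := MkHind (sub f).
have jE a b x y : j (a *: x + b *: y) = a *: j x + b *: j y by exact/val_inj.
exists j => // f A [V BV VA]; exists (j @^-1` V).
  split=> [x y a b Vx Vy ab|n] /=; first by rewrite jE; exact: BV.1.
  have /nbhs_HinfP[e e0 He] := BV.2 (c * n.+1).-1.
  apply/nbhs_HinfP; exists (e / expR (n.+1%:R * B)).
    by rewrite divr_gt0 ?expR_gt0.
  move=> g gH /=.
  pose g' := MkHinf (in_Hinf_dominated (dom n) (valP g)).
  have -> : j (@Hind_incl _ (under_seq M) n g) = Hind_incl g' by exact/val_inj.
  apply: He => z.
  apply: le_trans (ler_wpM2l (normc_ge0 _) (dom n _ (normc_ge0 z))) _.
  rewrite mulrCA mulrC -ler_pdivlMr ?expR_gt0 //; exact: gH.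
move=> g /= Vg; apply: VA => /=.
by have := jE 1 (-1) g f; rewrite !scale1r !scaleN1r => <-.
Qed.

(** The step with exponent 1/(c(n+1)) of M goes into the step with exponent
    1/(n+1) of N. *)
Lemma omega_prec_Hproj (M N : LC R) : omega_prec M N ->
  continuous_inclusion (@Hproj_fun R (over_seq M)) (@Hproj_fun R (over_seq N)).
Proof.
move=> [c [B [c0 B0 H]]].
pose m n := (c * n.+1).-1.
pose K n := expR ((m n).+1%:R^-1 * B).
have dom n t : 0 <= t -> over_seq N n t <= K n * over_seq M (m n) t.
  apply: (@vMc_dominated M N ((m n).+1%:R^-1)%:pos _ _ _ H) => /=.
  rewrite prednK ?muln_gt0 ?c0 // natrM invfM mulrAC mulVf ?mul1r //.
  by rewrite pnatr_eq0 -lt0n.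
have sub (f : Hproj (over_seq M)) : (f : _ -> _) \in in_Hproj (over_seq N).
  apply/in_HprojP => n; apply: (in_Hinf_dominated (dom n)).
  exact: (valP (Hproj_proj (m n) f)).
exists (fun f => MkHproj (sub f)) => //.
apply/Hproj_universal => n f A /nbhs_HinfP[e e0 He].
have K0 : 0 < K n by exact: expR_gt0.
suff : nbhs (Hproj_proj (m n) f) [set g | forall z,
    Normc.normc (g z - f z) * over_seq N n (Normc.normc z) <= e].
  move=> /(@Hproj_proj_continuous _ _ (m n) f).
  by apply: (@filterS _ (nbhs f)) => g gH; exact: He.
apply/nbhs_HinfP; exists (e / K n); first by rewrite divr_gt0.
move=> g gH z.
apply: le_trans (ler_wpM2l (normc_ge0 _) (dom n _ (normc_ge0 z))) _.
by rewrite mulrCA mulrC -ler_pdivlMr.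
Qed.

End inclusions.

(** * Necessity: testing on monomials *)

Section monomials.
Local Open Scope complex_scope.
Context {R : realType} (M : LC R).

Definition monomial (a : R) (j : nat) : R[i]^o -> R[i]^o :=
  fun z => a%:C * z ^+ j.

Lemma monomial_entire a j : entire (monomial a j).
Proof. by move=> z; apply: derivableZ; exact: exprn_derivable. Qed.

Lemma normc_real (x : R) : Normc.normc x%:C = `|x|.
Proof. by rewrite /= expr0n addr0 sqrtr_sqr. Qed.

Lemma normc_monomial a j (z : R[i]) :
  Normc.normc (monomial a j z) = `|a| * Normc.normc z ^+ j.
Proof.
rewrite /monomial Normc.normcM normc_real; congr (_ * _).
elim: j => [|j IH]; first by rewrite !expr0 Normc.normc1.
by rewrite !exprS Normc.normcM IH.
Qed.

(** After raising to the power m this is t^{mj} exp(- omega_M(t)) <= M_{mj}.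
    Integer exponents use m = 1, exponents 1/m use m itself. *)
Lemma monomial_bound (a : R) j (c : {posnum R}) (m : nat) (z : R[i]^o) :
  0 <= a -> (0 < m)%N -> 1 <= m%:R * c%:num ->
  Normc.normc (monomial a j z) * vMc M c (Normc.normc z) <=
    a * (M (m * j)%N) `^ (m%:R^-1).
Proof.
move=> a0 m0 mc; rewrite normc_monomial ger0_norm // -mulrA ler_wpM2l //.
set t := Normc.normc z; have t0 : 0 <= t := normc_ge0 z.
rewrite -(ler_pXn2r m0) ?nnegrE ?powR_ge0 ?mulr_ge0 ?exprn_ge0 ?expR_ge0 //.
rewrite exprn_root ?(ltW (LC_gt0 _ _)) // exprMn -exprM mulnC /vMc /= -expRM_natl.
apply: (@le_trans _ _ (t ^+ (m * j) * expR (- omega M t))).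
  rewrite ler_wpM2l ?exprn_ge0 // ler_expR mulrN lerN2 mulrA.
  by rewrite ler_peMl // omega_ge0.
by rewrite expRN ler_pdivrMr ?expR_gt0 // expr_le_omega.
Qed.

Lemma monomial_in_Hinf a j (c : {posnum R}) :
  monomial a j \in in_Hinf (vMc M c).
Proof.
apply/in_HinfP; split; first exact: monomial_entire.
pose m := Num.Def.archi_bound c%:num^-1.
have c'0 : 0 <= c%:num^-1 by rewrite invr_ge0.
have mc := archi_boundP c'0.
have m0 : (0 < m)%N by rewrite -(ltr_nat R) (le_lt_trans _ mc).
exists (`|a| * (M (m * j)%N) `^ (m%:R^-1)) => _ [z _ <-].
have -> : Normc.normc (monomial a j z) = Normc.normc (monomial `|a| j z).
  by rewrite !normc_monomial normr_id.
apply: monomial_bound => //; rewrite -ler_pdivrMr // mul1r; exact: ltW.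
Qed.

End monomials.

Section necessity.
Local Open Scope complex_scope.
Context {R : realType} (M N : LC R).

(** If no constants work, there are points t_n where omega_M beats
    (n+1) omega_N + n; bounding g(t_n) by exp((n+1) omega_N(t_n)) is a
    0-neighbourhood that the functions e z^j / M_j cannot all enter. *)
Lemma Hind_omega_prec :
  continuous_inclusion (@Hind_fun R (under_seq M)) (@Hind_fun R (under_seq N)) ->
  omega_prec M N.
Proof.
move=> [J JE Jc]; apply: contrapT => noprec.
have /choice[t tP] n : exists t, n.+1%:R * omega N t + n%:R < omega M t.
  apply: contrapT => not; apply: noprec; exists n.+1, n%:R; split=> // t.
  by rewrite leNgt; apply/negP => lt; apply: not; exists t.
have t0 n : 0 < t n.
  rewrite ltNge; apply/negP => tn; have := tP n.
  by rewrite ltNge omega_small ?(le_trans tn) // addr_ge0 ?mulr_ge0 ?omega_ge0.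
pose V := [set g : Hind (under_seq N) |
  forall n, Normc.normc (g (t n)%:C) <= expR (n.+1%:R * omega N (t n))].
have BV : Hind_base V.
  split=> [x y a b Vx Vy ab n|k].
    rewrite (_ : (a *: x + b *: y) _ = a * x (t n)%:C + b * y (t n)%:C) //.
    apply: le_trans (le_normcD _ _) _; rewrite !Normc.normcM.
    apply: le_trans (lerD (ler_wpM2l (normc_ge0 a) (Vx n))
                          (ler_wpM2l (normc_ge0 b) (Vy n))) _.
    rewrite -mulrDl ler_piMl ?expR_ge0 // -lecR rmorphD; exact: ab.
  (* For n < k the radius exp(- s) alone gives |g(t_n)| <= 1. *)
  pose s := \sum_(i < k) k.+1%:R * omega N (t i).
  have term0 i : 0 <= k.+1%:R * omega N (t i) by rewrite mulr_ge0 ?omega_ge0.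
  have s0 : 0 <= s by apply: sumr_ge0.
  apply/nbhs_HinfP; exists (expR (- s)); first exact: expR_gt0.
  move=> g gH n /=; have := gH (t n)%:C.
  rewrite (_ : (0 : Hinf _) _ = 0) // subr0 normc_real gtr0_norm //.
  rewrite /under_fun /vMc /= [X in _ * X]expRN ler_pdivrMr ?expR_gt0 // -expRD.
  move=> /le_trans; apply; rewrite ler_expR.
  have [kn|nk] := leqP k n.
    rewrite addrC lerBlDr; apply: (@le_trans _ _ (n.+1%:R * omega N (t n))).
      by rewrite ler_wpM2r ?omega_ge0 // ler_nat ltnS.
    by rewrite lerDl.
  apply: (@le_trans _ _ 0); last by rewrite mulr_ge0 ?omega_ge0.
  rewrite addrC subr_le0 /s (bigD1 (Ordinal nk)) //= lerDl.
  by apply: sumr_ge0.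
have J0 : J 0 = 0 by apply/val_inj; exact: (JE 0).
have : nbhs (0 : Hind (under_seq M)) (J @^-1` V).
  apply: Jc; rewrite J0; exists V => // g /=.
  by rewrite subr0.
move=> [W [_ /(_ 0%N) /nbhs_HinfP[e e0 He]] WV].
have test j n : e / M j * t n ^+ j <= expR (n.+1%:R * omega N (t n)).
  pose g : Hinf (under_seq M 0%N) := MkHinf (monomial_in_Hinf M (e / M j) j _).
  have eM : 0 <= e / M j by rewrite divr_ge0 ?ltW ?LC_gt0.
  have Wg : W (@Hind_incl _ (under_seq M) 0%N g).
    apply: He => z; rewrite (_ : (0 : Hinf _) _ = 0) // subr0.
    apply: le_trans (monomial_bound M (e / M j) j _ 1%N z eM _ _) _ => //=.
      by rewrite mul1r.
    by rewrite mul1n invr1 powRr1 ?divfK // ?gt_eqF ?LC_gt0 // ltW // LC_gt0.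
  have : V (J (@Hind_incl _ (under_seq M) 0%N g)) by apply: WV; rewrite /= subr0.
  move=> /(_ n); rewrite JE /= normc_monomial normc_real.
  by rewrite ger0_norm // gtr0_norm.
(* Any n > - ln e contradicts the choice of t_n. *)
pose n := Num.Def.archi_bound `|ln e|.
have ne : - ln e < n%:R.
  by apply: le_lt_trans (archi_boundP (normr_ge0 _)); rewrite -normrN ler_norm.
have := tP n; rewrite ltNge => /negP; apply.
apply: omega_le_expr => // j.
rewrite expRD.
apply: (@le_trans _ _ (M j * (expR (n.+1%:R * omega N (t n)) / e))).
  rewrite mulrA ler_pdivlMr // mulrC -ler_pdivrMl ?LC_gt0 //.
  by rewrite mulrA [_^-1 * e]mulrC test.
rewrite ler_pM2l ?LC_gt0 // ler_pM2l ?expR_gt0 //.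
by rewrite -[e]lnK ?posrE // -expRN ler_expR ltW.
Qed.

(** The seminorms of the projective limit increase with n, so one of them
    suffices; using 1/(n+1) also as the radius leaves a single index. *)
Lemma Hproj_nbhs0 (A : set (Hproj (over_seq M))) : nbhs 0 A ->
  exists n, forall f : Hproj (over_seq M),
    (forall z,
      Normc.normc (f z) * over_seq M n (Normc.normc z) <= n.+1%:R^-1) -> A f.
Proof.
pose D n := [set f : Hproj (over_seq M) |
  forall z, Normc.normc (f z) * over_seq M n (Normc.normc z) <= n.+1%:R^-1].
have over_mono m n z : (m <= n)%N ->
    over_seq M m (Normc.normc z) <= over_seq M n (Normc.normc z).
  by move=> mn; apply: vMc_anti; rewrite /= lef_pV2 ?posrE // ler_nat ltnS.
have FF : Filter (filter_from setT D).
  apply: filter_from_filter; first by exists 0%N.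
  have Dmono m n : (m <= n)%N -> D n `<=` D m.
    move=> mn f fD z; apply: le_trans (le_trans (fD z) _).
      by rewrite ler_wpM2l ?normc_ge0 // over_mono.
    by rewrite lef_pV2 ?posrE // ler_nat ltnS.
  move=> m n _ _; exists (maxn m n) => // f fD.
  by split; apply: Dmono fD; [exact: leq_maxl|exact: leq_maxr].
have cvg0 : filter_from setT D --> (0 : Hproj (over_seq M)).
  apply/Hproj_cvg => n B /nbhs_HinfP[e e0 He].
  pose k := maxn n (Num.Def.archi_bound e^-1).
  exists k => // f fD; apply: He => z.
  rewrite (_ : _ - _ = f z); last exact: subr0.
  apply: (@le_trans _ _ (Normc.normc (f z) * over_seq M k (Normc.normc z))).
    by rewrite ler_wpM2l ?normc_ge0 // over_mono // leq_maxl.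
  apply: le_trans (fD z) _; rewrite -[e]invrK lef_pV2 ?posrE ?invr_gt0 //.
  have e'0 : 0 <= e^-1 by rewrite invr_ge0 ltW.
  apply: le_trans (ltW (archi_boundP e'0)) _.
  by rewrite ler_nat ltnW // ltnS leq_maxr.
by move=> /cvg0[n _ DA]; exists n => f /DA.
Qed.

(** The norm of z^j for v_N is N_j, its norm for v_M^{1/(n+1)} is at most the
    root of M_{(n+1)j}; comparing the two is the sequence condition. *)
Lemma Hproj_omega_prec :
  continuous_inclusion (@Hproj_fun R (over_seq M)) (@Hproj_fun R (over_seq N)) ->
  omega_prec M N.
Proof.
move=> [J JE Jc]; apply/omega_prec_seqP.
have J0 : J 0 = 0 by apply/val_inj; exact: (JE 0).
have : nbhs (0 : Hproj (over_seq M)) [set f | forall z,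
    Normc.normc (f z) * over_seq N 0%N (Normc.normc z) <= 1].
  have : nbhs (Hproj_proj 0%N (J 0)) [set g : Hinf (over_seq N 0%N) | forall z,
      Normc.normc (g z) * over_seq N 0%N (Normc.normc z) <= 1].
    rewrite J0; apply/nbhs_HinfP; exists 1 => // g gH z.
    by have := gH z; rewrite (_ : g z - _ = g z) //; exact: subr0.
  move=> /(@Hproj_proj_continuous _ _ 0%N (J 0))/Jc.
  apply: (@filterS _ (nbhs (0 : Hproj (over_seq M)))) => f /= H z.
  by have := H z; rewrite JE.
move=> /Hproj_nbhs0[n nH].
exists n.+1, n.+1%:R; split=> [//||j]; first by rewrite ler1n.
set r := _ `^ _; have r0 : 0 < r by rewrite powR_gt0 // LC_gt0.
pose a := (n.+1%:R * r)^-1.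
have a0 : 0 < a by rewrite invr_gt0 mulr_gt0.
have sub : monomial a j \in in_Hproj (over_seq M).
  by apply/in_HprojP => k; exact: monomial_in_Hinf.
have [t t0 tE] := omega_attained N j.
have /(_ _)/(_ t%:C) := nH (MkHproj sub).
rewrite normc_monomial normc_real !gtr0_norm // => H.
have : a * N j <= 1.
  apply: le_trans (H _) => [|z]; last first.
    apply: le_trans (monomial_bound M a j _ n.+1 z (ltW a0) isT _) _.
      by rewrite /= divff.
    by rewrite /a invfM -/r mulfVK // gt_eqF.
  by rewrite -mulrA ler_pM2l // /vMc /= invr1 mul1r expRN ler_pdivlMr ?expR_gt0 // tE.
by rewrite /a mulrC ler_pdivrMr ?mul1r // mulr_gt0.
Qed.

End necessity.

(** * The equivalences *)

Lemma same_spaceP {T : Type} {X Y : topologicalType}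
    {iX : X -> T} {iY : Y -> T} :
  injective iX -> injective iY ->
  same_space iX iY <-> continuous_inclusion iX iY /\ continuous_inclusion iY iX.
Proof.
have one (A B : topologicalType) (iA : A -> T) (iB : B -> T) :
    injective iB -> same_space iA iB -> continuous_inclusion iA iB.
  move=> injB [rE oE].
  have /choice[j jE] a : exists b, iB b = iA a.
    have : range iA (iA a) by exists a.
    by rewrite rE => -[b _ <-]; exists b.
  exists j => //; apply/continuousP => V oV.
  have VE : iB @^-1` (iB @` V) = V.
    by apply/seteqP; split=> [b [b' Vb' /injB <-//]|b Vb]; exists b.
  have -> : j @^-1` V = iA @^-1` (iB @` V).
    by rewrite -[in LHS]VE; apply/seteqP; split=> a; rewrite /= jE.
  by apply/oE; rewrite VE.
have sub (A B : topologicalType) (iA : A -> T) (iB : B -> T) :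
    continuous_inclusion iA iB -> range iA `<=` range iB /\
    forall U : set T, open (iB @^-1` U) -> open (iA @^-1` U).
  move=> [j jE jc]; split=> [_ [a _ <-]|U oU]; first by exists (j a).
  have -> : iA @^-1` U = j @^-1` (iB @^-1` U).
    by apply/seteqP; split=> a; rewrite /= jE.
  by move/continuousP : jc; exact.
move=> injX injY; split=> [XY|[/sub[XY oYX] /sub[YX oXY]]].
  split; first exact: one.
  apply: one => //; split; first by rewrite XY.1.
  by move=> U; split=> /XY.2.
by split=> [|U]; [apply/seteqP|split; [exact: oXY|exact: oYX]].
Qed.

Theorem theorem3p20 (R : realType) (M N : LC R) :
  let cond_i := exists (c : nat) (A : R), [/\ (0 < c)%N, 1 <= A &
    forall j : nat, N j <= A * (M (c * j)%N) `^ (c%:R^-1)] in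
  let cond_ii := weight_prec (vM M) (vM N) in
  let cond_iii := continuous_inclusion
    (@Hind_fun R (under_seq M)) (@Hind_fun R (under_seq N)) in
  let cond_iv := continuous_inclusion
    (@Hproj_fun R (over_seq M)) (@Hproj_fun R (over_seq N)) in
  [/\ cond_i <-> cond_ii, cond_ii <-> cond_iii & cond_iii <-> cond_iv] /\
  (weight_sim (vM M) (vM N) <->
    same_space (@Hind_fun R (under_seq M)) (@Hind_fun R (under_seq N))) /\
  (weight_sim (vM M) (vM N) <->
    same_space (@Hproj_fun R (over_seq M)) (@Hproj_fun R (over_seq N))).
Proof.
have ind (P Q : LC R) : weight_prec (vM P) (vM Q) <-> continuous_inclusion
    (@Hind_fun R (under_seq P)) (@Hind_fun R (under_seq Q)).
  rewrite weight_precP; split; [exact: omega_prec_Hind|exact: Hind_omega_prec].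
have proj (P Q : LC R) : weight_prec (vM P) (vM Q) <-> continuous_inclusion
    (@Hproj_fun R (over_seq P)) (@Hproj_fun R (over_seq Q)).
  rewrite weight_precP; split; [exact: omega_prec_Hproj|exact: Hproj_omega_prec].
have injH (w : weight_seq R) : injective (@Hind_fun R w) by exact: val_inj.
have injP (u : nat -> weight R) : injective (@Hproj_fun R u) by exact: val_inj.
split; [split|split].
- by rewrite weight_precP omega_prec_seqP.
- exact: ind.
- by split=> [/ind/proj|/proj/ind].
- apply: iff_trans (iff_sym (same_spaceP (injH _) (injH _))).
  by split=> -[/ind ? /ind ?].
- apply: iff_trans (iff_sym (same_spaceP (injP _) (injP _))).
  by split=> -[/proj ? /proj ?].
Qed.
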